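(* For any integers $a>b\geq 1$ there exists $n_0$ such that for all integers $n>n_0$ there is an $n$-uniform hypergraph with at most $$\frac{e}{2}\,n^2\left(\frac{a}{b}\right)^n b\left(\ln\frac{a}{b}+1\right)$$ edges which is not $(a:b)$-colorable.
   Context: A hypergraph is a pair $H=(V,E)$, where $V$ is the set of vertices and $E$ is a family (set, without repetitions) of subsets of $V$, called edges. It is $n$-uniform if every edge contains exactly $n$ vertices. An $(a:b)$-coloring of $H$ assigns to each vertex $v\in V$ a set of exactly $b$ distinct colors from $[a]=\{1,\ldots,a\}$, i.e. it is a map $\chi:V\to\binom{[a]}{b}$. An edge $A\in E$ is properly colored if no single color is shared by all vertices of $A$, i.e. $\bigcap_{v\in A}\chi(v)=\varnothing$. The hypergraph $H$ is $(a:b)$-colorable if there is such a map $\chi$ under which every edge is properly colored. Here $e$ is the base of the natural logarithm $\ln$. *)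

(* Defs.v *)
From mathcomp Require Import all_boot.

Set Implicit Arguments.
Unset Strict Implicit.
Unset Printing Implicit Defensive.

(* A hypergraph on the finite vertex set V is given by its set of edges. *)
Definition hypergraph (V : finType) := {set {set V}}.

Definition is_uniform (V : finType) (n : nat) (E : hypergraph V) : Prop :=
  forall A : {set V}, A \in E -> #|A| = n.

(* The colors 1, ..., a are represented by the elements 0, ..., a - 1 of 'I_a. *)
Definition is_coloring (V : finType) (a b : nat) (chi : V -> {set 'I_a}) : Prop :=
  forall v : V, #|chi v| = b.

(* The intersection over an empty edge is the whole palette. *)
Definition properly_colored (V : finType) (a : nat) (chi : V -> {set 'I_a})
    (A : {set V}) : Prop :=
  \bigcap_(v in A) chi v = set0.

Definition colorable (V : finType) (a b : nat) (E : hypergraph V) : Prop :=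
  exists2 chi : V -> {set 'I_a},
    is_coloring b chi & forall A : {set V}, A \in E -> properly_colored chi A.

(* Main.v *)
Require Import Defs.
From mathcomp Require Import all_boot all_order all_algebra.
From mathcomp Require Import all_classical all_reals all_analysis.
From mathcomp Require Import zify ring lra.
Import Order.TTheory GRing.Theory Num.Theory.
Local Open Scope ring_scope.

(** This is Erdos' random construction of a hypergraph without property B,
    carried over to (a:b)-colorings and made deterministic.

    Take a t vertices, with t of order n^2. Whatever the coloring, its color
    classes have average size b t, so by convexity of binomial coefficients a
    proportion at least p = (a/b) 'C(b t, n) / 'C(a t, n) of all n-sets is not
    properly colored ([improper_edges_ge]). There are 'C(a, b)^(a t) colorings,
    and each edge, if chosen well, spoils a proportion p of those that are not
    spoiled yet ([greedy_cover]). So m edges spoil all colorings as soon as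
    p m > a t ln 'C(a, b).

    It remains to choose t. The density p is about
    (a/b)^(1 - n) exp (- n^2 (a - b) / (2 a b t)) ([bin_ratio]), hence m must be
    about b t (a/b)^n exp (n^2 (a - b) / (2 a b t)) ln 'C(a, b). This is least
    when the exponent equals 1, that is b t = (1 - b/a) n^2 / 2. Then
    m is about (e/2) n^2 (1 - b/a) (a/b)^n ln 'C(a, b), and ln 'C(a, b) is at most
    b (ln (a/b) + 1) ([bin_le_expR]). The factor 1 - b/a < 1 leaves room for all
    error terms when n is large ([edge_budget_suffices]). *)

(** * Edges made improper by a given coloring *)

(** The number of (n + 1)-subsets of a k-set is convex in k, and its slope at k is 'C(k, n). Both sides carry a positive term so that the tangent-line
    inequality needs no truncated subtraction. *)
Lemma bin_tangent (c k n : nat) :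
  ('C(k, n.+1) + c * 'C(k, n) <= 'C(c, n.+1) + k * 'C(k, n))%N.
Proof.
have mono i j : (i <= j)%N -> ('C(i, n) <= 'C(j, n))%N by apply: leq_bin2l.
case: (leqP k c) => [|/ltnW] /subnK <-.
  elim: (c - k)%N => [//|d IH]; rewrite addSn binS.
  have := mono k (d + k)%N (leq_addl _ _); nia.
elim: (k - c)%N => [//|d IH]; rewrite addSn binS.
have := mono (d + c)%N (d + c).+1 (leqnSn _); nia.
Qed.

(** Summing the tangent lines at the mean: their linear terms cancel. *)
Lemma bin_jensen (I : finType) (c : I -> nat) (k n : nat) :
  (\sum_i c i = #|I| * k)%N ->
  (#|I| * 'C(k, n.+1) <= \sum_i 'C(c i, n.+1))%N.
Proof.
move=> sc; have : (\sum_i ('C(k, n.+1) + c i * 'C(k, n))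
                   <= \sum_i ('C(c i, n.+1) + k * 'C(k, n)))%N.
  by apply: leq_sum => i _; apply: bin_tangent.
by rewrite !big_split /= -big_distrl /= sc !sum_nat_const mulnA leq_add2r.
Qed.

(** The a color classes have average size b t, so by convexity there are at
    least a 'C(b t, n) pairs of a color and an n-set inside its class. An n-set
    is counted once per color common to its vertices, hence at most b times,
    since the common colors all belong to any one of its vertices. *)
Lemma improper_edges_ge (V : finType) (a b t n : nat) (chi : V -> {set 'I_a}) :
  (0 < n)%N -> is_coloring b chi -> #|V| = (a * t)%N ->
  (a * 'C(b * t, n) <=
   b * #|[set A : {set V} in [set B : {set V} | #|B| == n]
            | \bigcap_(v in A) chi v != finset.set0]%SET|)%N.
Proof.
case: n => // n _ chib cardV; pose cls i := [set v | i \in chi v]%SET.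
have cover_sub (i : 'I_a) (A : {set V}) :
    (i \in \bigcap_(v in A) chi v)%SET = (A \subset cls i).
  apply/finset.bigcapP/fintype.subsetP => h v vA; first by rewrite inE h.
  by have := h v vA; rewrite inE.
have sumc : (\sum_i #|cls i| = #|'I_a| * (b * t))%N.
  under eq_bigr => i _ do rewrite -sum1dep_card.
  rewrite (exchange_big_dep xpredT) //=.
  under eq_bigr => v _ do rewrite sum1_card chib.
  by rewrite sum_nat_const cardV card_ord; lia.
have := bin_jensen _ _ _ n sumc; rewrite card_ord => /leq_trans; apply.
under eq_bigr => i _ do rewrite -cards_draws -sum1dep_card.
(* Count the pairs by n-set instead of by color. *)
rewrite (exchange_big_dep (fun A : {set V} => #|A| == n.+1)) /=; last first.
  by move=> i A _ /andP[].
rewrite mulnC -sum_nat_const big_mkcond [leqRHS]big_mkcond.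
apply: leq_sum => A _; rewrite !inE; case: eqP => //= cA.
have -> : (\sum_(i < a | (A \subset cls i) && true) 1
           = #|\bigcap_(v in A) chi v|%SET)%N.
  by rewrite -sum1_card; apply: eq_bigl => i; rewrite andbT cover_sub.
case: eqP => [->|_]; first by rewrite cards0.
have /card_gt0P[v vA] : (0 < #|A|)%N by rewrite cA.
rewrite -(chib v); apply: fintype.subset_leq_card; exact: finset.bigcap_inf.
Qed.

(** * Greedy covering *)

(** If every x in F is hit by a proportion at least p of the y in D, then by
    averaging some y hits a proportion at least p of the x not hit so far. Each
    of m steps that pick such a y divides the number of x not hit by at least
    e^p, as 1 - p <= e^(- p). Picking m elements of D at random would leave as
    few on average. *)
Lemma greedy_cover (R : realType) (X Y : finType) (r : X -> Y -> bool)
    (F : {set X}) (D : {set Y}) (p : R) (m : nat) :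
  (0 < #|D|)%N ->
  (forall x, x \in F -> p * #|D|%:R <= #|[set y in D | r x y]%SET|%:R) ->
  exists S : {set Y}, [/\ S \subset D, (#|S| <= m)%N
    & #|[set x in F | ~~ [exists y in S, r x y]]%SET|%:R
        <= expR (- (p * m%:R)) * #|F|%:R].
Proof.
move=> D0 rich; elim: m => [|m [S [SD Sm US]]].
  exists finset.set0; rewrite finset.sub0set cards0 mulr0 oppr0 expR0 mul1r ler_nat.
  split=> //; apply/fintype.subset_leq_card/fintype.subsetP => x.
  by rewrite inE => /andP[].
set U := [set x in F | _]%SET in US.
have [y yD hy] : exists2 y, y \in D &
    p * #|U|%:R <= #|[set x in U | r x y]%SET|%:R.
  apply/exists_inP; apply: contraT; rewrite negb_exists_in => /forall_inP noy.
  have : \sum_(x in U) \sum_(y in D | r x y) 1 < p * #|U|%:R * #|D|%:R :> R.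
    rewrite (exchange_big_dep (mem D)) /=; last by move=> x y _ /andP[].
    rewrite mulr_natr -sumr_const; apply: ltr_sum.
      by have /card_gt0P[y yD] := D0; apply/hasP; exists y; rewrite ?mem_index_enum.
    move=> y yD; have := noy y yD; rewrite -ltNge; congr (_ < _).
    by rewrite -sum1dep_card natr_sum; apply: eq_bigl => x; rewrite yD.
  rewrite ltNge => /negP[]; rewrite mulrAC mulr_natr -sumr_const.
  apply: ler_sum => x; rewrite inE => /andP[xF _].
  by rewrite (le_trans (rich x xF))// -sum1dep_card natr_sum.
exists (y |: S)%SET; split.
- by rewrite finset.subUset finset.sub1set yD.
- by rewrite finset.cardsU1; case: (_ \notin _) => //=; rewrite ?add0n ?add1n //;
     apply: ltnW.
have -> : [set x in F | ~~ [exists z in y |: S, r x z]]%SET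
          = (U :\: [set x in U | r x y])%SET.
  apply/setP => x; rewrite !inE; case: (x \in F) => //=; rewrite ?andbF //.
  have -> : [exists z in y |: S, r x z]%SET = r x y || [exists z in S, r x z].
    apply/exists_inP/orP => [[z]|[h|/exists_inP[z zS h]]].
    - rewrite !inE => /predU1P[-> |zS h]; first by left.
      by right; apply/exists_inP; exists z.
    - by exists y; rewrite ?finset.setU11.
    - by exists z; rewrite // !inE zS orbT.
  by rewrite negb_or; case: (r x y) => //=; case: [exists z in S, _].
rewrite finset.cardsD (finset.setIidPr _);
  last by apply/fintype.subsetP => x; rewrite inE => /andP[].
rewrite natrB;
  last by apply/fintype.subset_leq_card/fintype.subsetP => x; rewrite inE => /andP[].
apply: (@le_trans _ _ (expR (- p) * #|U|%:R)).
  have := expR_ge1Dx (- p); have : 0 <= #|U|%:R :> R by []. nra.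
rewrite -natr1 mulrDr mulr1 opprD addrC expRD -mulrA ler_pM2l ?expR_gt0 //.
Qed.

(** * Estimates of binomial coefficients *)

(** Stirling's lower bound for k!, up to a polynomial factor: k^k / k! grows by
    the factor (1 + 1/k)^k <= e from k to k + 1. *)
Lemma exprnn_le_fact_expR (R : realType) (k : nat) :
  k%:R ^+ k <= k`!%:R * expR k%:R :> R.
Proof.
elim: k => [|k IH]; first by rewrite expR0 mulr1.
(* The growth factor makes sense only from k = 1 on. *)
case: k IH => [|k] IH.
  rewrite expr1 (_ : 1`! = 1)%N // mul1r.
  by apply: le_trans (expR_ge1Dx _); rewrite lerDr.
set x : R := k.+1%:R in IH *.
have x0 : 0 < x by rewrite ltr0n.
have e1 : (1 + x^-1) ^+ k.+1 <= expR 1.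
  have -> : expR 1 = expR x^-1 ^+ k.+1 by rewrite -expRM_natl mulfV ?gt_eqF.
  by rewrite lerXn2r ?nnegrE ?expR_ge0 ?expR_ge1Dx // addr_ge0 // invr_ge0 ltW.
have y_fact : k.+2%:R = x * (1 + x^-1) :> R.
  by rewrite mulrDr mulfV ?gt_eqF // mulr1 -natr1 -/x.
have -> : k.+2%:R ^+ k.+2 = k.+2%:R * (x ^+ k.+1 * (1 + x^-1) ^+ k.+1) :> R.
  by rewrite exprS -exprMn -y_fact.
have -> : (k.+2)`!%:R * expR k.+2%:R
    = k.+2%:R * ((k.+1)`!%:R * expR x * expR 1) :> R.
  by rewrite factS natrM -[in expR _]natr1 expRD -/x !mulrA.
rewrite ler_pM2l ?ltr0n //; apply: ler_pM => //; apply: exprn_ge0.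
  exact: ltW.
by rewrite addr_ge0 // invr_ge0 ltW.
Qed.

(** A crude estimate of the number of color sets is enough: replacing 'C(a, b)
    by (e a / b)^b is what produces the factor b (ln (a/b) + 1) in the
    number of edges. *)
Lemma bin_le_expR (R : realType) (a b : nat) : (0 < b)%N -> (0 < a)%N ->
  'C(a, b)%:R <= expR (b%:R * (ln (a%:R / b%:R) + 1)) :> R.
Proof.
move=> b0 a0.
rewrite mulrDr mulr1 expRD mulrC expRM_natl lnK ?posrE ?divr_gt0 ?ltr0n //.
rewrite -(ler_pM2r (x := b`!%:R)) ?ltr0n ?fact_gt0 //.
rewrite -natrM bin_ffact.
apply: (@le_trans _ _ (a%:R ^+ b)).
  rewrite -natrX ler_nat ffact_prod -[in leqRHS](card_ord b) -prod_nat_const.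
  by apply: leq_prod => i _; apply: leq_subr.
rewrite expr_div_n mulrAC mulrC -mulrA ler_peMr ?exprn_ge0 //.
rewrite mulrC ler_pdivlMr ?exprn_gt0 ?ltr0n // mul1r mulrC.
exact: exprnn_le_fact_expR.
Qed.

(** The ratio 'C(K, n) / 'C(N, n) is the product over i < n of
    (K - i) / (N - i), and each factor falls short of K / N only by the factor
    1 + i (N - K) / (N (K - i)), which is at most the exponential of i s with
    s = (N - K) / (N (K - n)). These exponents add up to at most n^2 s / 2. *)
Lemma bin_ratio (R : realType) (N K n : nat) : (K <= N)%N -> (n < K)%N ->
  K%:R ^+ n * 'C(N, n)%:R <= N%:R ^+ n * 'C(K, n)%:R *
    expR (n%:R ^+ 2 / 2 * ((N%:R - K%:R) / (N%:R * (K%:R - n%:R)))) :> R.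
Proof.
move=> KN nK; set s := (X in _ / 2 * X).
have K0 : 0 < K%:R :> R by rewrite ltr0n; lia.
have N0 : 0 < N%:R :> R by rewrite ltr0n; lia.
have nKR : n%:R < K%:R :> R by rewrite ltr_nat.
have KNR : K%:R <= N%:R :> R by rewrite ler_nat.
have s0 : 0 <= s by rewrite divr_ge0 ?mulr_ge0 ?subr_ge0 // ltW.
(* With s fixed, the bound holds for falling factorials of any length up to n,
   by induction on that length. *)
suff H j : (j <= n)%N -> K%:R ^+ j * (N ^_ j)%:R <=
    N%:R ^+ j * (K ^_ j)%:R * expR (j%:R ^+ 2 / 2 * s) :> R.
  rewrite -(ler_pM2r (x := n`!%:R)) ?ltr0n ?fact_gt0 //.
  have := H n (leqnn _); rewrite -!bin_ffact !natrM => Hn.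
  rewrite -[leLHS]mulrA; apply: (le_trans Hn).
  by rewrite le_eqVlt; apply/orP; left; apply/eqP; ring.
elim: j => [_|j IH jn].
  by rewrite !ffactn0 !expr0 !mul1r -[leLHS]expR0 ler_expR expr2 !mul0r.
rewrite !ffactnSr !exprS !natrM !natrB; [|lia..].
have jnR : j%:R + 1 <= n%:R :> R by rewrite natr1 ler_nat.
have j0 : 0 <= j%:R :> R by [].
have step : K%:R * (N%:R - j%:R) <= N%:R * (K%:R - j%:R) * expR (j%:R * s) :> R.
  apply: (@le_trans _ _ (N%:R * (K%:R - j%:R) * (1 + j%:R * s))); last first.
    by rewrite ler_pM2l ?expR_ge1Dx // mulr_gt0 //; lra.
  have -> : K%:R * (N%:R - j%:R) =
      N%:R * (K%:R - j%:R) + j%:R * (N%:R - K%:R) :> R by ring.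
  rewrite [leRHS]mulrDr mulr1 lerD2l mulrCA ler_wpM2l //.
  have -> : N%:R * (K%:R - j%:R) * s =
    (N%:R - K%:R) * ((K%:R - j%:R) / (K%:R - n%:R)).
    by rewrite /s; field; rewrite !gt_eqF // subr_gt0.
  by rewrite ler_peMr ?subr_ge0 // ler_pdivlMr; lra.
apply: (@le_trans _ _ ((N%:R ^+ j * (K ^_ j)%:R * expR (j%:R ^+ 2 / 2 * s)) *
   (N%:R * (K%:R - j%:R) * expR (j%:R * s)))).
  have -> : K%:R * K%:R ^+ j * ((N ^_ j)%:R * (N%:R - j%:R)) =
   K%:R ^+ j * (N ^_ j)%:R * (K%:R * (N%:R - j%:R)) :> R by ring.
  apply: ler_pM; [exact: mulr_ge0|by apply: mulr_ge0; lra| |exact: step].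
  by apply: IH; lia.
have -> : N%:R ^+ j * (K ^_ j)%:R * expR (j%:R ^+ 2 / 2 * s) *
  (N%:R * (K%:R - j%:R) * expR (j%:R * s)) =
  N%:R * N%:R ^+ j * ((K ^_ j)%:R * (K%:R - j%:R)) *
  expR (j%:R ^+ 2 / 2 * s + j%:R * s) by rewrite expRD; ring.
apply: ler_wpM2l.
  by rewrite !mulr_ge0 ?exprn_ge0 ?subr_ge0 // ler_nat; lia.
by rewrite ler_expR -mulrDl ler_wpM2r // -(natr1 j) expr0; lra.
Qed.

(** Once b t is at least w0 = n^2 (a - b) / (2 a), the exponent given by
    [bin_ratio] for N = a t and K = b t is w0 / (b t - n), hence at
    most 1 + O(1 / n): this is where the factor e of the theorem comes from. *)
Lemma improper_density_ge (R : realType) (a b n t : nat) :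
  (0 < b)%N -> (b < a)%N -> (4 * a < n)%N ->
  n%:R ^+ 2 * (a%:R - b%:R) / (2 * a%:R) <= b%:R * t%:R :> R ->
  (n < b * t)%N /\
  a%:R / b%:R / (a%:R / b%:R) ^+ n * (expR (-1) * (1 - 4 * a%:R / n%:R)) <=
  a%:R * 'C(b * t, n)%:R / (b%:R * 'C(a * t, n)%:R) :> R.
Proof.
move=> b0 ba an ht.
have bR : 0 < b%:R :> R by rewrite ltr0n.
have aR : 0 < a%:R :> R by rewrite ltr0n; lia.
have nR : 4 * a%:R < n%:R :> R by rewrite -natrM ltr_nat.
have baR : b%:R + 1 <= a%:R :> R by rewrite natr1 ler_nat.
set w : R := b%:R * t%:R in ht.
have wn : n%:R ^+ 2 <= 2 * a%:R * w.
  have : n%:R ^+ 2 * (a%:R - b%:R) <= 2 * a%:R * w.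
    by move: ht; rewrite ler_pdivrMr ?mulr_gt0 // (mulrC w).
  nra.
have w2n : 2 * n%:R <= w by nra.
have ntR : n%:R < w by lra.
have nt : (n < b * t)%N by rewrite -(ltr_nat R) natrM.
split=> //.
have t0 : 0 < t%:R :> R by rewrite ltr0n; nia.
have CN0 : 0 < 'C(a * t, n)%:R :> R by rewrite ltr0n bin_gt0; nia.
set q : R := a%:R / b%:R.
have q0 : 0 < q by rewrite divr_gt0.
have := @bin_ratio R (a * t) (b * t) n; rewrite leq_mul2r (ltnW ba) orbT.
move=> /(_ isT nt); set x := (X in expR X).
(* The exponent is at most w / (w - n), and n / w is at most 2 a / n. *)
have hx : x <= 1 + 4 * a%:R / n%:R.
  have -> : x = n%:R ^+ 2 * (a%:R - b%:R) / (2 * a%:R) / (w - n%:R).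
    rewrite /x !natrM /w; field.
    by rewrite !gt_eqF // subr_gt0.
  apply: (@le_trans _ _ (w / (w - n%:R))).
    by rewrite ler_wpM2r // invr_ge0; lra.
  rewrite ler_pdivrMr; last lra.
  have -> : 1 + 4 * a%:R / n%:R = (n%:R + 4 * a%:R) / n%:R :> R.
    by field; rewrite gt_eqF //; lra.
  rewrite mulrAC ler_pdivlMr; last lra.
  by nra.
move=> ratio.
have -> : a%:R * 'C(b * t, n)%:R / (b%:R * 'C(a * t, n)%:R) =
    q * ('C(b * t, n)%:R / 'C(a * t, n)%:R) :> R.
  by rewrite /q; field; rewrite !gt_eqF.
rewrite -mulrA ler_pM2l // ler_pdivlMr //.
have tn0 : 0 < (b%:R * t%:R) ^+ n :> R by rewrite exprn_gt0 ?mulr_gt0.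
have scale : (a * t)%:R ^+ n = q ^+ n * (b%:R * t%:R) ^+ n :> R.
  by rewrite -exprMn natrM; congr (_ ^+ _); rewrite /q; field; rewrite gt_eqF.
rewrite scale natrM -/w in ratio.
have qn0 : 0 < q ^+ n by rewrite exprn_gt0.
have {}ratio : 'C(a * t, n)%:R <= q ^+ n * 'C(b * t, n)%:R * expR x.
  by rewrite -(ler_pM2l tn0); apply: (le_trans ratio); rewrite le_eqVlt;
     apply/orP; left; apply/eqP; ring.
have decay : expR (-1) * (1 - 4 * a%:R / n%:R) * expR x <= 1.
  apply: (@le_trans _ _ (expR (-1) * expR (- (4 * a%:R / n%:R)) * expR x)).
    by rewrite ler_wpM2r ?expR_ge0 // ler_wpM2l ?expR_ge0 // expR_ge1Dx.
  by rewrite -!expRD -[leRHS]expR0 ler_expR; lra.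
rewrite -[leLHS]mulrA ler_pdivrMl //.
set d := expR (-1) * _ in decay *.
have d0 : 0 <= d.
  rewrite mulr_ge0 ?expR_ge0 // subr_ge0 ler_pdivrMr; lra.
apply: (le_trans (ler_wpM2l d0 ratio)).
have -> : d * (q ^+ n * 'C(b * t, n)%:R * expR x) =
  (d * expR x) * (q ^+ n * 'C(b * t, n)%:R) by ring.
by rewrite ler_piMl // mulr_ge0 // ltW.
Qed.

(** * The number of edges *)

(** With q = a / b, the density is about q^(1 - n) / e, so m edges suffice as
    soon as m exceeds e q^(n - 1) a t L = e q^n b t L. As b t is about
    (1 - b/a) n^2 / 2, the budget (e/2) n^2 q^n L is larger than needed by the
    constant factor 1 / (1 - b/a), and this absorbs all the errors: the relative
    error 4 a / n of the density, the rounding of t to an integer, and the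
    rounding of the budget, which costs the final - 1. *)
Lemma edge_budget_suffices (R : realType) (a b n t : nat) (q L : R) :
  (0 < b)%N -> (b < a)%N -> (4 * a ^ 2 + 2 * a * b.+1 < n)%N -> 1 <= L ->
  b%:R * t%:R <= n%:R ^+ 2 * (a%:R - b%:R) / (2 * a%:R) + b%:R :> R ->
  q = a%:R / b%:R ->
  a%:R * t%:R * L <
    q / q ^+ n * (expR (-1) * (1 - 4 * a%:R / n%:R)) *
    (expR 1 / 2 * n%:R ^+ 2 * q ^+ n * L - 1).
Proof.
move=> b0 ba an L1 ht qE.
have bR : 0 < b%:R :> R by rewrite ltr0n.
have aR : 0 < a%:R :> R by rewrite ltr0n; lia.
have baR : b%:R + 1 <= a%:R :> R by rewrite natr1 ler_nat.
have b1R : 1 <= b%:R :> R by rewrite ler1n.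
have nR : 4 * a%:R ^+ 2 + 2 * a%:R * (b%:R + 1) < n%:R :> R.
  by rewrite natr1 -natrX -!natrM -natrD ltr_nat.
have n0 : 0 < n%:R :> R by nra.
have q1 : 1 <= q by rewrite qE ler_pdivlMr // mul1r; lra.
have q0 : 0 < q by lra.
have qn1 : 1 <= q ^+ n by rewrite exprn_ege1.
set Q := q ^+ n in qn1 *; have Q0 : 0 < Q by lra.
set h : R := 1 - _.
have h0 : 0 < h.
  by rewrite subr_gt0 ltr_pdivrMr // mul1r; nra.
have main : b%:R * t%:R < h * (n%:R ^+ 2 / 2 - 1).
  apply: (le_lt_trans ht).
  (* The gain n^2 b / (2 a) must exceed 2 a n + 1 + b, whence the threshold. *)
  have -> : n%:R ^+ 2 * (a%:R - b%:R) / (2 * a%:R) + b%:R =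
     n%:R ^+ 2 / 2 - n%:R ^+ 2 * b%:R / (2 * a%:R) + b%:R :> R.
    by field; rewrite gt_eqF.
  have -> : h * (n%:R ^+ 2 / 2 - 1) =
     n%:R ^+ 2 / 2 - 2 * a%:R * n%:R - 1 + 4 * a%:R / n%:R.
    by rewrite /h; field; rewrite gt_eqF.
  have : 0 < 4 * a%:R / n%:R :> R by rewrite divr_gt0 // mulr_gt0.
  have : 2 * a%:R * n%:R + 1 + b%:R < n%:R ^+ 2 * b%:R / (2 * a%:R) :> R.
    rewrite ltr_pdivlMr ?mulr_gt0 //.
    apply: (@lt_le_trans _ _ (n%:R ^+ 2)); last by rewrite ler_peMr ?sqr_ge0.
    have u0 : 0 < 2 * a%:R * (b%:R + 1) :> R by rewrite !mulr_gt0 ?addr_gt0.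
    have n1 : 1 <= n%:R :> R by rewrite ler1n -(ltr0n R).
    have := ler_wpM2l (ltW u0) n1.
    have : (4 * a%:R ^+ 2 + 2 * a%:R * (b%:R + 1)) * n%:R < n%:R * n%:R :> R.
      by rewrite ltr_pM2r.
    lra.
  lra.
have e1 : expR (-1) * expR 1 = 1 :> R by rewrite -expRD addNr expR0.
have -> : q / Q * (expR (-1) * h) * (expR 1 / 2 * n%:R ^+ 2 * Q * L - 1) =
  q * h * ((expR (-1) * expR 1) * n%:R ^+ 2 / 2 * L - expR (-1) / Q).
  by field; rewrite gt_eqF.
rewrite e1 mul1r.
have small : expR (-1) / Q <= L.
  apply: le_trans L1; rewrite ler_pdivrMr // mul1r; apply: le_trans qn1.
  by rewrite -[leRHS]expR0 ler_expR; lra.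
apply: (@lt_le_trans _ _ (q * h * (n%:R ^+ 2 / 2 - 1) * L)).
  rewrite ltr_pM2r; last lra.
  have -> : a%:R * t%:R = q * (b%:R * t%:R).
    by rewrite qE; field; rewrite gt_eqF.
  by rewrite -mulrA ltr_pM2l.
rewrite -[leLHS]mulrA ler_wpM2l ?mulr_ge0 ?(ltW q0) ?(ltW h0) //; lra.
Qed.

Theorem theorem2 (R : realType) (a b : nat) (hb : (1 <= b)%N) (hab : (b < a)%N) :
  exists n0 : nat, forall n : nat, (n0 < n)%N ->
    exists (V : finType) (H : hypergraph V),
      [/\ is_uniform n H,
          #|H|%:R <= expR 1 / 2 * n%:R ^+ 2 * (a%:R / b%:R) ^+ n * b%:R
                       * (ln (a%:R / b%:R) + 1) :> R
        & ~ colorable a b H].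
Proof.
exists (4 * a ^ 2 + 2 * a * b.+1)%N => n hn.
have aR : 0 < a%:R :> R by rewrite ltr0n; lia.
have bR : 0 < b%:R :> R by rewrite ltr0n.
have baR : b%:R + 1 <= a%:R :> R by rewrite natr1 ler_nat.
have b1R : 1 <= b%:R :> R by rewrite ler1n.
set q : R := a%:R / b%:R; set L : R := b%:R * (ln q + 1).
have L1 : 1 <= L.
  have : 0 <= ln q by rewrite ln_ge0 // ler_pdivlMr // mul1r; lra.
  rewrite /L; nra.
have q0 : 0 < q by rewrite divr_gt0.
set B : R := _ * (ln q + 1).
have BE : B = expR 1 / 2 * n%:R ^+ 2 * q ^+ n * L by rewrite /B /L mulrA.
have B0 : 0 <= B.
  rewrite BE; apply: mulr_ge0; last lra.
  by rewrite !mulr_ge0 ?expR_ge0 ?exprn_ge0 ?sqr_ge0 ?invr_ge0 // ltW.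
have /andP[mB Bm] := truncn_itv B0; set m := Num.truncn B in mB Bm.
(* With a t vertices and t close to r, the number of vertices is the one that
   minimizes the product of ln #|F| and the inverse density. *)
pose r : R := n%:R ^+ 2 * (a%:R - b%:R) / (2 * a%:R) / b%:R.
have r0 : 0 <= r.
  by rewrite !divr_ge0 ?mulr_ge0 ?sqr_ge0 ?subr_ge0 ?ler_nat // ltnW.
have /andP[tr rt] := truncn_itv r0; pose t := (Num.truncn r).+1.
have brE : b%:R * r = n%:R ^+ 2 * (a%:R - b%:R) / (2 * a%:R).
  by rewrite /r mulrC divfK ?gt_eqF.
have t_ge : n%:R ^+ 2 * (a%:R - b%:R) / (2 * a%:R) <= b%:R * t%:R :> R.
  by rewrite -brE ler_pM2l // ltW.
have t_le : b%:R * t%:R <= n%:R ^+ 2 * (a%:R - b%:R) / (2 * a%:R) + b%:R :> R.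
  by rewrite -brE -[X in _ + X]mulr1 -mulrDr ler_pM2l // /t -natr1 lerD2r.
have an : (4 * a < n)%N.
  apply: leq_ltn_trans hn; apply: leq_trans (leq_addr _ _).
  by rewrite leq_mul2l -[leqLHS]expn1 leq_pexp2l // (ltn_trans hb).
have [nt dens] := @improper_density_ge R a b n t hb hab an t_ge.
have budget := @edge_budget_suffices R a b n t q L hb hab hn L1 t_le erefl.
set p : R := a%:R * 'C(b * t, n)%:R / (b%:R * 'C(a * t, n)%:R) in dens.
have pm : a%:R * t%:R * L < p * m%:R.
  apply: lt_le_trans budget _; rewrite -BE.
  apply: (@le_trans _ _ (q / q ^+ n * (expR (-1) * (1 - 4 * a%:R / n%:R)) * m%:R)).
    rewrite ler_wpM2l //; last by rewrite -natr1 in Bm; lra.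
    rewrite !mulr_ge0 ?expR_ge0 ?invr_ge0 ?exprn_ge0 ?(ltW q0) //.
    rewrite subr_ge0 ler_pdivrMr ?ltr0n ?(leq_ltn_trans _ an) //.
    by rewrite mul1r -natrM ler_nat ltnW.
  by rewrite ler_wpM2r.
pose V : finType := 'I_(a * t).
pose D : {set {set V}} := [set A : {set V} | #|A| == n]%SET.
pose F : {set {ffun V -> {set 'I_a}}} :=
  [set f in ffun_on (mem [set B : {set 'I_a} | #|B| == b]%SET)]%SET.
pose bad (f : {ffun V -> {set 'I_a}}) (A : {set V}) :=
  (\bigcap_(v in A) f v != finset.set0)%SET.
have cardD : #|D| = 'C(a * t, n) by rewrite card_draws card_ord.
have D0 : (0 < #|D|)%N.
  by rewrite cardD bin_gt0 ltnW // (leq_trans nt) // leq_mul2r ltnW ?orbT.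
have F_col f : f \in F -> is_coloring b f.
  by rewrite inE => /ffun_onP fF v; have := fF v; rewrite inE => /eqP.
have rich f : f \in F -> p * #|D|%:R <= #|[set A in D | bad f A]%SET|%:R.
  move=> /F_col fcol.
  have C0 : 'C(a * t, n)%:R != 0 :> R by rewrite gt_eqF // ltr0n -cardD.
  rewrite cardD /p invfM mulrA (divfK C0) ler_pdivrMr // [leRHS]mulrC.
  rewrite -!natrM ler_nat.
  apply: improper_edges_ge fcol _; last by rewrite card_ord.
  exact: leq_ltn_trans an.
have cardF : #|F|%:R <= expR (a%:R * t%:R * L).
  have -> : #|F| = ('C(a, b) ^ (a * t))%N.
    by rewrite cardsE card_ffun_on card_draws !card_ord.
  rewrite natrX -natrM expRM_natl; apply: lerXn2r; rewrite ?nnegrE ?expR_ge0 //.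
  by apply: bin_le_expR => //; apply: ltn_trans hab.
have [S [SD Sm unhit]] := greedy_cover R _ _ bad F D p m D0 rich.
exists V, S; split.
- by move=> A /(fintype.subsetP SD); rewrite inE => /eqP.
- by apply: le_trans mB; rewrite ler_nat.
case=> chi chib proper.
(* Fewer than one coloring is left, so none is. *)
have : [set f in F | ~~ [exists A in S, bad f A]]%SET = finset.set0.
  apply/eqP; rewrite -cards_eq0 -leqn0 -ltnS -(ltr_nat R).
  apply: le_lt_trans unhit _.
  apply: le_lt_trans (ler_wpM2l (expR_ge0 _) cardF) _.
  by rewrite -expRD -[ltRHS]expR0 ltr_expR; lra.
move/finset.setP/(_ [ffun v => chi v]); rewrite !inE => /negP[].
apply/andP; split.
  by apply/ffun_onP => v; rewrite ffunE inE chib.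
rewrite negb_exists_in; apply/forall_inP => A AS; rewrite /bad negbK.
by under eq_bigr => v _ do rewrite ffunE; rewrite proper.
Qed.
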